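(* Write $\dfrac{(q;q)_\infty^2}{(q^5;q^5)_\infty^3}=\sum_{n\ge0}a_nq^n$. Then for all $n\ge0$: $a_n>0$ if $n\equiv0,3,4\pmod5$, and $a_n<0$ if $n\equiv1,2\pmod5$.
   Context: For $|q|<1$, $(a;q)_\infty=\prod_{k\ge0}(1-aq^k)$. *)

(* Defs.v *)
(* formal power series coefficients computed via exact
   polynomial truncations over int. *)
From HB Require Import structures.
From mathcomp Require Import all_boot all_order all_algebra.
Set Implicit Arguments. Unset Strict Implicit. Unset Printing Implicit Defensive.
Import GRing.Theory Num.Theory.
Local Open Scope ring_scope.

(* Truncation of (q^m;q^m)_oo = prod_{k>=1} (1 - q^(m k)) to the factors k <= N.
   Modulo q^(N+1) (for m >= 1) it agrees with the infinite product. *)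
Definition qpoch_trunc (m N : nat) : {poly int} :=
  \prod_(1 <= k < N.+1) (1 - 'X^(m * k)).

(* Truncation of 1/(q^m;q^m)_oo = prod_{k>=1} sum_{j>=0} q^(m k j) to k <= N
   and j <= N.  Modulo q^(N+1) (for m >= 1) it agrees with the formal power
   series 1/(q^m;q^m)_oo. *)
Definition inv_qpoch_trunc (m N : nat) : {poly int} :=
  \prod_(1 <= k < N.+1) \sum_(0 <= j < N.+1) 'X^(m * k * j).

Definition a (n : nat) : int :=
  ((qpoch_trunc 1 n) ^+ 2 * (inv_qpoch_trunc 5 n) ^+ 3)`_n.

(* Main.v *)
(** Put A = sum (-1)^k X^((5k^2+3k)/2) and B = sum (-1)^k X^((5k^2+k)/2), k ranging over Z, and
    write E_m for (X^m;X^m)_oo and Q for X^5.  By the Jacobi triple product (the limit of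
    the q-binomial theorem), A and B are the products of (1 - X^k) over k = 0, 1, 4 and over
    k = 0, 2, 3 (mod 5), whence A B = E_1 E_5.
    The exponents of the double series A B are, up to an affine change, norms of Gaussian integers
    divisible by 2 - i.  Accordingly Z^2 splits into the 5 cosets of the lattice spanned by (2, -1)
    and (1, 2), on each of which A B restricts to a power of X times a double series in Q.  Two
    of the five vanish by antisymmetry, the other three give
      E_1 E_5 = B(Q)^2 - X A(Q) B(Q) - X^2 A(Q)^2.
    Squaring and dividing by E_5^5 gives
      E_1^2 / E_5^3 = W_0(Q) - 2 X W_1(Q) - X^2 W_2(Q) + 2 X^3 W_3(Q) + X^4 W_4(Q),
      W_t = A^t B^(4-t) / E_1^5 = (1/E_1) (A/E_1)^t (B/E_1)^(4-t).
    As A/E_1 and B/E_1 are products of geometric series and 1/E_1 has positive coefficients, all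
    coefficients of every W_t are positive. *)
Require Import Defs.
From HB Require Import structures.
From mathcomp Require Import all_boot all_order all_algebra.
From mathcomp Require Import zify ring.
Set Implicit Arguments.
Unset Strict Implicit.
Unset Printing Implicit Defensive.
Import GRing.Theory Num.Theory.
Local Open Scope ring_scope.

(** * Congruence modulo a power of X *)

(** Power series are handled through polynomial truncations: an identity of series becomes a
    congruence modulo ['X^K], that is, agreement of the coefficients below [K]. *)
Definition eqmodX (K : nat) (p r : {poly int}) := exists s, p - r = s * 'X^K.

Lemma eqmodX_refl K p : eqmodX K p p.
Proof. by exists 0; rewrite subrr mul0r. Qed.

Lemma eqmodX_sym K p r : eqmodX K p r -> eqmodX K r p.
Proof. by case=> s e; exists (- s); rewrite mulNr -e opprB. Qed.

Lemma eqmodX_trans K r p t : eqmodX K p r -> eqmodX K r t -> eqmodX K p t.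
Proof. by case=> s e [s' e']; exists (s + s'); rewrite mulrDl -e -e'; ring. Qed.

Lemma eqmodXD K p r p' r' :
  eqmodX K p r -> eqmodX K p' r' -> eqmodX K (p + p') (r + r').
Proof. by case=> s e [s' e']; exists (s + s'); rewrite mulrDl -e -e'; ring. Qed.

Lemma eqmodXM K p r p' r' :
  eqmodX K p r -> eqmodX K p' r' -> eqmodX K (p * p') (r * r').
Proof.
case=> s e [s' e']; exists (p * s' + s * r').
by rewrite mulrDl -[p * s' * _]mulrA -e' mulrAC -e; ring.
Qed.

Lemma eqmodXX K p r n : eqmodX K p r -> eqmodX K (p ^+ n) (r ^+ n).
Proof.
move=> e; elim: n => [|n IH]; first by rewrite !expr0; apply: eqmodX_refl.
by rewrite !exprS; apply: eqmodXM.
Qed.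

Lemma eqmodX_sum K (I : eqType) (s : seq I) (P : pred I) F G :
  (forall i, i \in s -> P i -> eqmodX K (F i) (G i)) ->
  eqmodX K (\sum_(i <- s | P i) F i) (\sum_(i <- s | P i) G i).
Proof.
move=> h; rewrite big_seq_cond [X in eqmodX _ _ X]big_seq_cond.
apply: (big_ind2 (eqmodX K)) => [|*|i /andP[]]; [exact: eqmodX_refl|exact: eqmodXD|].
exact: h.
Qed.

Lemma eqmodX_sum0 K (I : eqType) (s : seq I) (P : pred I) F :
  (forall i, i \in s -> P i -> eqmodX K (F i) 0) -> eqmodX K (\sum_(i <- s | P i) F i) 0.
Proof. by move/eqmodX_sum/eqmodX_trans; apply; rewrite big1 //; apply: eqmodX_refl. Qed.

Lemma eqmodX_prod K (I : eqType) (s : seq I) (P : pred I) F G :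
  (forall i, i \in s -> P i -> eqmodX K (F i) (G i)) ->
  eqmodX K (\prod_(i <- s | P i) F i) (\prod_(i <- s | P i) G i).
Proof.
move=> h; rewrite big_seq_cond [X in eqmodX _ _ X]big_seq_cond.
apply: (big_ind2 (eqmodX K)) => [|*|i /andP[]]; [exact: eqmodX_refl|exact: eqmodXM|].
exact: h.
Qed.

Lemma eqmodX_prod1 K (I : eqType) (s : seq I) (P : pred I) F :
  (forall i, i \in s -> P i -> eqmodX K (F i) 1) -> eqmodX K (\prod_(i <- s | P i) F i) 1.
Proof. by move/eqmodX_prod/eqmodX_trans; apply; rewrite big1 //; apply: eqmodX_refl. Qed.

Lemma eqmodX_Xn K n p : (K <= n)%N -> eqmodX K ('X^n * p) 0.
Proof. by move=> h; exists (p * 'X^(n - K)); rewrite subr0 -mulrA -exprD subnK // mulrC. Qed.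

Lemma eqmodX_sub_Xn K n : (K <= n)%N -> eqmodX K (1 - 'X^n) 1.
Proof. by move=> h; exists (- 'X^(n - K)); rewrite mulNr -exprD subnK //; ring. Qed.

Lemma eqmodX_leq K K' p r : (K' <= K)%N -> eqmodX K p r -> eqmodX K' p r.
Proof. by move=> h [s e]; exists (s * 'X^(K - K')); rewrite e -mulrA -exprD subnK. Qed.

Lemma eqmodX_mulXn K n p r : eqmodX K p r -> eqmodX (n + K) ('X^n * p) ('X^n * r).
Proof. by case=> s e; exists s; rewrite -mulrBr e exprD mulrCA. Qed.

Lemma eqmodX_comp K m p r : (0 < m)%N ->
  eqmodX K p r -> eqmodX K (p \Po 'X^m) (r \Po 'X^m).
Proof.
move=> m0 [s e]; apply: (@eqmodX_leq (m * K)); first by rewrite leq_pmull.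
by exists (s \Po 'X^m); rewrite -comp_polyB e comp_polyM comp_Xn_poly exprM.
Qed.

Lemma eqmodX_coef K p r i : (i < K)%N -> eqmodX K p r -> p`_i = r`_i.
Proof.
move=> h [s e]; apply/eqP; rewrite -subr_eq0 -coefB e coefMXn h //.
Qed.

(** A polynomial with constant term 1 is invertible modulo ['X^K]: the geometric sum of the powers
    of [1 - u] is an inverse, since [1 - u] is a multiple of ['X]. *)
Lemma eqmodX_mulI K (u p r : {poly int}) : u`_0 = 1 -> eqmodX K (u * p) (u * r) -> eqmodX K p r.
Proof.
move=> u0 h.
have [w ew] : exists w, u = 1 + w * 'X.
  exists (\poly_(i < size u) u`_i.+1); apply/polyP=> -[|i].
    by rewrite coefD coefMX coef1 /= u0 addr0.
  rewrite coefD coefMX coef1 /= add0r coef_poly; case: ltnP => // hs.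
  by rewrite nth_default // leqW.
have hv : eqmodX K ((\sum_(i < K) (1 - u) ^+ i) * u) 1.
  have -> : (\sum_(i < K) (1 - u) ^+ i) * u = 1 - (1 - u) ^+ K.
    by rewrite -[RHS]opprB subrX1; ring.
  exists (- (- w) ^+ K); rewrite ew.
  have -> : 1 - (1 + w * 'X) = - w * 'X :> {poly int} by ring.
  by rewrite exprMn; ring.
move: (\sum_(i < K) _) hv => v hv.
have e x : eqmodX K (v * (u * x)) x.
  by rewrite mulrA -[X in eqmodX _ _ X]mul1r; apply: eqmodXM => //; apply: eqmodX_refl.
apply: eqmodX_trans (eqmodX_sym (e p)) _; apply: eqmodX_trans (e r).
by apply: eqmodXM => //; apply: eqmodX_refl.
Qed.

(** Serves to exchange finite summation ranges that differ only in terms of high order. *)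
Lemma eqmodX_big_seq K (T : eqType) (s1 s2 : seq T) (F : T -> {poly int}) :
    uniq s1 -> uniq s2 ->
    (forall x, x \in s1 -> x \notin s2 -> eqmodX K (F x) 0) ->
    (forall x, x \in s2 -> x \notin s1 -> eqmodX K (F x) 0) ->
  eqmodX K (\sum_(x <- s1) F x) (\sum_(x <- s2) F x).
Proof.
move=> u1 u2 h1 h2.
rewrite (bigID (fun x => x \in s2)) /= [X in eqmodX _ _ X](bigID (fun x => x \in s1)) /=.
apply: eqmodXD.
  rewrite -big_filter -[X in eqmodX _ _ X]big_filter.
  rewrite (@perm_big _ _ _ _ _ [seq x <- s2 | x \in s1]) ; first exact: eqmodX_refl.
  apply: uniq_perm; rewrite ?filter_uniq // => x.
  by rewrite !mem_filter andbC.
apply: (@eqmodX_trans _ 0); last apply: eqmodX_sym; exact: eqmodX_sum0.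
Qed.

(** * The q-binomial theorem *)

Section GaussBinomial.
Variables (R : comNzRingType) (q : R).

(** Gaussian binomials through the q-Pascal rule, which avoids division in [R]. *)
Fixpoint gbin (n k : nat) : R :=
  match n, k with
  | _, 0 => 1
  | 0, _.+1 => 0
  | n'.+1, k'.+1 => q ^+ k'.+1 * gbin n' k'.+1 + gbin n' k'
  end.

Lemma gbin0 n : gbin n 0 = 1. Proof. by case: n. Qed.

Lemma gbin_small n k : (n < k)%N -> gbin n k = 0.
Proof.
elim: n k => [|n IH] [|k] //= h.
by rewrite !IH ?mulr0 ?addr0 // ltnW.
Qed.

(** The q-factorial formula without division. The induction is the q-Pascal rule together with 1 -
    q^(n+1) = (1 - q^(k+1)) + q^(k+1) (1 - q^(n-k)). *)
Lemma gbin_prod n k : (k <= n)%N ->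
  gbin n k * (\prod_(i < k) (1 - q ^+ i.+1) * \prod_(i < n - k) (1 - q ^+ i.+1)) =
  \prod_(i < n) (1 - q ^+ i.+1).
Proof.
elim: n k => [|n IH] [|k] //.
- by move=> _; rewrite gbin0 subn0 !big_ord0 !mul1r.
- by move=> _; rewrite gbin0 subn0 big_ord0 !mul1r.
rewrite ltnS => hk /=; rewrite subSS.
have e1 := IH k hk.
have e2 : gbin n k.+1 * (\prod_(i < k.+1) (1 - q ^+ i.+1) *
     \prod_(i < n - k) (1 - q ^+ i.+1)) =
    (1 - q ^+ (n - k)) * \prod_(i < n) (1 - q ^+ i.+1).
  case: (ltnP k n) => h; last first.
    by rewrite gbin_small // (_ : (n - k = 0)%N) ?expr0 ?subrr ?mul0r //; lia.
  by rewrite -(IH k.+1 h) -(subnSK h) [X in _ * (_ * X) = _]big_ord_recr /=; ring.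
rewrite mulrDl -mulrA e2 [in RHS]big_ord_recr /=.
rewrite [X in _ + _ * (X * _)]big_ord_recr /=.
have -> : gbin n k * (\prod_(i < k) (1 - q ^+ i.+1) * (1 - q ^+ k.+1) *
   \prod_(i < n - k) (1 - q ^+ i.+1)) = (1 - q ^+ k.+1) * \prod_(i < n) (1 - q ^+ i.+1).
  by rewrite -e1; ring.
have -> : q ^+ n.+1 = q ^+ k.+1 * q ^+ (n - k) by rewrite -exprD addSn subnKC.
ring.
Qed.

(** Induction on [n]: splitting off the factor [i = 0] replaces [x] by [x * q] in the others. The
    homogeneous form allows [y] to be a power of X later, so that no negative exponents arise. *)
Lemma gbin_theorem n (x y : R) :
  \prod_(i < n) (y + x * q ^+ i) =
  \sum_(j < n.+1) gbin n j * q ^+ 'C(j, 2) * x ^+ j * y ^+ (n - j).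
Proof.
elim: n x => [|n IH] x.
  by rewrite big_ord0 big_ord1 /= !expr0 !mulr1.
rewrite big_ord_recl /= expr0 mulr1.
have -> : \prod_(i < n) (y + x * q ^+ bump 0 i) = \prod_(i < n) (y + x * q * q ^+ i).
  by apply: eq_bigr => i _; rewrite /bump /= add1n exprS; ring.
rewrite IH mulrDl !mulr_sumr.
rewrite [in RHS]big_ord_recl /= !expr0 !mul1r.
have -> : \sum_(i < n.+1) (q ^+ (bump 0 i) * gbin n (bump 0 i) + gbin n i) *
     q ^+ 'C(bump 0 i, 2) * x ^+ bump 0 i * y ^+ (n.+1 - bump 0 i) =
   \sum_(i < n.+1) y * (gbin n i.+1 * q ^+ 'C(i.+1, 2) * (x * q) ^+ i.+1 * y ^+ (n - i.+1)) +
   \sum_(i < n.+1) x * (gbin n i * q ^+ 'C(i, 2) * (x * q) ^+ i * y ^+ (n - i)).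
  rewrite -big_split; apply: eq_bigr => i _ /=; rewrite /bump /= add1n subSS.
  have -> : y * (gbin n i.+1 * q ^+ 'C(i.+1, 2) * (x * q) ^+ i.+1 * y ^+ (n - i.+1)) =
      gbin n i.+1 * q ^+ 'C(i.+1, 2) * (x * q) ^+ i.+1 * y ^+ (n - i).
    case: (ltnP i n) => h; last by rewrite gbin_small // !mul0r mulr0.
    by rewrite -(subnSK h) [y ^+ _.+1]exprS; ring.
  rewrite binS bin1 exprD !exprMn [x ^+ _.+1]exprS.
  move: (gbin n i) (gbin n i.+1) (q ^+ _) (q ^+ 'C(_, _)) (q ^+ i) (x ^+ i) (y ^+ _) => *; ring.
rewrite [in LHS]big_ord_recl [X in _ = _ + (X + _)]big_ord_recr /=.
rewrite [gbin n n.+1]gbin_small // !mul0r mulr0 addr0 gbin0 !expr0 !mulr1 !mul1r subn0.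
by rewrite -exprS addrA; congr (_ + _ + _).
Qed.

End GaussBinomial.

(** * The Jacobi triple product *)

(* Equal to 5k(k-1)/2 + ck; nonnegative for 0 <= c <= 5, so [absz] loses nothing there. *)
Definition theta_exp (c : nat) (k : int) : nat :=
  `|((5 * k * (k - 1) + 2 * c%:Z * k) %/ 2)%Z|%N.

(** The halving is exact because k(k-1) is even; the value is nonnegative because k and 5(k-1) + 2c
    have the same sign for k >= 1 and for k <= -1, when c <= 5. *)
Lemma theta_expE (c : nat) (k : int) : (c <= 5)%N ->
  2 * (theta_exp c k)%:Z = 5 * k * (k - 1) + 2 * c%:Z * k.
Proof.
move=> hc; rewrite /theta_exp.
have [m em] : exists m, 5 * k * (k - 1) + 2 * c%:Z * k = m * 2.
  have e := divz_eq k 2; have h0 := modz_ge0 k (isT : 2 != 0 :> int).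
  have h2 := ltz_mod k (isT : 2 != 0 :> int).
  move: e h0 h2; move: (k %/ 2)%Z (k %% 2)%Z => u v e h0 h2.
  have [v0|v1] : v = 0 \/ v = 1 by lia.
    by exists (5 * u * (k - 1) + c%:Z * k); rewrite e v0; ring.
  by exists (5 * k * u + c%:Z * k); rewrite e v1; ring.
rewrite em mulzK //.
have : 0 <= m.
  have [k0|[k0|k0]] : k = 0 \/ 0 <= k - 1 \/ 0 <= - k - 1 by lia.
  - by move: em; rewrite k0; lia.
  - by nia.
  - have h5 : 0 <= 5 - c%:Z by lia.
    by nia.
by case: m {em} => // m _; rewrite absz_nat mulrC.
Qed.

Lemma double_bin2 n : (2 * 'C(n, 2) + n = n * n)%N.
Proof. by elim: n => // n IH; rewrite binS bin1; nia. Qed.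

(* The homogeneous q-binomial theorem with 2n factors, at x = -X^c, y = X^(5n), divided by a
   power of X. *)
Lemma finite_triple_product (c n : nat) : (c <= 5)%N ->
  \prod_(i < n) ((1 - 'X^(5 * i + c)) * (1 - 'X^(5 * i + (5 - c)))) =
  \sum_(j < (n + n).+1)
     (-1) ^+ (j + n) * gbin ('X^5) (n + n) j * 'X^(theta_exp c (j%:Z - n%:Z)) :> {poly int}.
Proof.
move=> hc.
have H := gbin_theorem ('X^5 : {poly int}) (n + n) (- 'X^c) ('X^(5 * n)).
have S (x : {poly int}) : x ^+ n = \prod_(i < n) x by rewrite prodr_const card_ord.
have D : \prod_(i < n) 'X^(5 * i + c) = 'X^(5 * 'C(n, 2) + c * n) :> {poly int}.
  elim: n {H S} => [|n IH]; first by rewrite big_ord0 muln0.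
  by rewrite big_ord_recr /= IH -exprD binS bin1; congr ('X^_); lia.
(* The factors of index below n, taken in reverse, are -X^(5(n-1-i)+c) (1 - X^(5i+5-c)); those of
   index n+i are X^(5n) (1 - X^(5i+c)). *)
have L : \prod_(i < n + n) ('X^(5 * n) + - 'X^c * 'X^5 ^+ i) =
    (-1) ^+ n * 'X^(5 * 'C(n, 2) + c * n + 5 * n * n) *
    \prod_(i < n) ((1 - 'X^(5 * i + c)) * (1 - 'X^(5 * i + (5 - c)))) :> {poly int}.
  rewrite big_split_ord /= (reindex_inj rev_ord_inj) /=.
  have -> : \prod_(j < n) ('X^(5 * n) + - 'X^c * 'X^5 ^+ (n - j.+1)) =
      (-1) ^+ n * 'X^(5 * 'C(n, 2) + c * n) * \prod_(i < n) (1 - 'X^(5 * i + (5 - c))) :> {poly int}.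
    rewrite -D [X in _ * X * _](reindex_inj rev_ord_inj) /=.
    rewrite S -!big_split; apply: eq_bigr => i _ /=.
    have hi := ltn_ord i.
    have -> : 'X^(5 * n) = 'X^(5 * (n - i.+1) + c) * 'X^(5 * i + (5 - c)) :> {poly int}.
      by rewrite -exprD; congr ('X^_); lia.
    by rewrite exprD -exprM; ring.
  have -> : \prod_(i < n) ('X^(5 * n) + - 'X^c * 'X^5 ^+ (n + i)) =
      'X^(5 * n * n) * \prod_(i < n) (1 - 'X^(5 * i + c)) :> {poly int}.
    rewrite (exprM _ (5 * n) n) S -!big_split; apply: eq_bigr => i _ /=.
    rewrite mulrDr mulr1 mulrN mulNr -exprM -!exprD; congr (_ - 'X^_); lia.
  by rewrite big_split !exprD /=; ring.
have nz : (-1) ^+ n * 'X^(5 * 'C(n, 2) + c * n + 5 * n * n) != 0 :> {poly int}.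
  by rewrite mulf_neq0 ?signr_eq0 // monic_neq0 // monicXn.
apply: (mulfI nz); rewrite -L H mulr_sumr; apply: eq_bigr => j _.
have hj := ltn_ord j.
(* Recentring the summation index at n: the exponent exceeds that of the common monomial by exactly
   the theta exponent at j - n. *)
have E : (5 * 'C(j, 2) + c * j + 5 * n * (n + n - j) =
    5 * 'C(n, 2) + c * n + 5 * n * n + theta_exp c (j%:Z - n%:Z))%N.
  have := theta_expE (j%:Z - n%:Z) hc; have := double_bin2 j; have := double_bin2 n.
  move: (theta_exp _ _) => e.
  have [k ek] : exists k, (n + n = j + k)%N by exists (n + n - j)%N; lia.
  have -> : (n + n - j = k)%N by lia.
  nia.
rewrite -[X in _ = X * _]mulr1.
have -> : (-1) ^+ n * 'X^(5 * 'C(n, 2) + c * n + 5 * n * n) * 1 *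
   ((-1) ^+ (j + n) * gbin 'X^5 (n + n) j * 'X^(theta_exp c (j%:Z - n%:Z))) =
   ((-1) ^+ n * (-1) ^+ n) * (-1) ^+ j * gbin 'X^5 (n + n) j *
     ('X^(5 * 'C(n, 2) + c * n + 5 * n * n + theta_exp c (j%:Z - n%:Z))) :> {poly int}.
  by rewrite [in RHS]exprD [(-1) ^+ (j + n)]exprD; ring.
rewrite -E -[(-1) ^+ n * (-1) ^+ n]expr2 sqrr_sign mul1r.
rewrite -!exprM [(- 'X^c) ^+ j]exprNn -exprM !exprD; ring.
Qed.

(* The integers -L, ..., L-1: this interval is stable under k |-> -1-k. *)
Definition zbox (L : nat) : seq int := [seq i%:Z - L%:Z | i <- iota 0 (2 * L)].

Lemma mem_zbox L (k : int) : (k \in zbox L) = (- L%:Z <= k) && (k < L%:Z).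
Proof.
apply/mapP/andP => [[i]|[h1 h2]]; first by rewrite mem_iota => /andP[_ h] ->; lia.
by exists (absz (k + L%:Z)); [rewrite mem_iota|]; lia.
Qed.

Lemma zbox_uniq L : uniq (zbox L).
Proof. by rewrite map_inj_uniq ?iota_uniq // => i j; lia. Qed.

(** * Truncated theta series and their product form *)

Definition zsign (k : int) : {poly int} := (-1) ^+ `|k|%N.

Lemma eq_zsign (j k : int) : odd `|j|%N = odd `|k|%N -> zsign j = zsign k.
Proof. by rewrite /zsign -signr_odd => ->; rewrite signr_odd. Qed.

Lemma zsignD (j k : int) : zsign (j + k) = zsign j * zsign k.
Proof. by rewrite /zsign -exprD -signr_odd -[in RHS]signr_odd; congr (_ ^+ nat_of_bool _); lia. Qed.

(** [theta 4] and [theta 3] are the truncations of A and B respectively. *)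
Definition theta (c L : nat) : {poly int} :=
  \sum_(k <- zbox L) zsign k * 'X^(theta_exp c k).

(** Controls the tails: a term of index k with [|k|] at least K vanishes modulo X^K. *)
Lemma theta_exp_ge (c : nat) (k : int) : (0 < c < 5)%N -> (`|k| <= theta_exp c k)%N.
Proof.
move=> hc; have := @theta_expE c k; move: (theta_exp _ _) => e.
have [h1 h2] : 0 <= c%:Z - 1 /\ 0 <= 4 - c%:Z by lia.
case: (lerP 0 k) => k0 /(_ ltac:(lia)) E.
  suff: 0 <= 5 * k * (k - 1) + 2 * (c%:Z - 1) * k by lia.
  have [->|k1] : k = 0 \/ 0 <= k - 1 by lia.
    by lia.
  by nia.
suff: 0 <= 5 * k * (k - 1) + 2 * (c%:Z + 1) * k by lia.
have k1 : 0 <= - k - 1 by lia.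
by nia.
Qed.

Lemma coef0_prod_subXn (I : Type) (s : seq I) (P : pred I) (f : I -> nat) :
  (forall i, (0 < f i)%N) -> (\prod_(i <- s | P i) (1 - 'X^(f i)) : {poly int})`_0 = 1.
Proof.
move=> h; rewrite coef0_prod big1 // => i _.
by rewrite coefB coef1 coefXn (ltn_eqF (h i)) subr0.
Qed.

Lemma eqmodX_prod_subXn d m : (d <= m)%N ->
  eqmodX (5 * d.+1) (\prod_(i < m) (1 - ('X^5) ^+ i.+1)) (\prod_(i < d) (1 - ('X^5) ^+ i.+1)).
Proof.
elim: m => [|m IH]; first by rewrite leqn0 => /eqP->; apply: eqmodX_refl.
rewrite leq_eqVlt => /orP[/eqP->|]; first exact: eqmodX_refl.
rewrite ltnS => h; rewrite big_ord_recr -[X in eqmodX _ _ X]mulr1 /=.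
by apply: eqmodXM; [exact: IH|rewrite -exprM; apply: eqmodX_sub_Xn; lia].
Qed.

(** By [gbin_prod] the left side is (Q)_n (Q)_2n / ((Q)_j (Q)_(2n-j)). All four products have at
    least d factors, so they agree up to order 5(d+1) and cancel. *)
Lemma gbin_limit n j d : (d <= j)%N -> (j + d <= n + n)%N -> (d <= n)%N ->
  eqmodX (5 * d.+1) (gbin 'X^5 (n + n) j * \prod_(i < n) (1 - ('X^5) ^+ i.+1)) 1.
Proof.
move=> h1 h2 h3.
have U0 : (\prod_(i < n) (1 - ('X^5) ^+ i.+1) : {poly int})`_0 = 1.
  by under eq_bigr do rewrite -exprM; exact: coef0_prod_subXn.
have e m : (d <= m)%N -> eqmodX (5 * d.+1) (\prod_(i < n) (1 - ('X^5) ^+ i.+1))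
    (\prod_(i < m) (1 - ('X^5) ^+ i.+1)).
  move=> h; apply: eqmodX_trans (eqmodX_prod_subXn h3) _.
  exact/eqmodX_sym/eqmodX_prod_subXn.
apply: (eqmodX_mulI U0); rewrite mulr1 mulrCA.
have hj : (j <= n + n)%N by lia.
apply: eqmodX_trans (eqmodX_sym (e (n + n)%N _)); last by lia.
rewrite -(gbin_prod _ hj); apply: eqmodXM; first exact: eqmodX_refl.
by apply: eqmodXM; apply: e; lia.
Qed.

Lemma triple_product (c K : nat) : (0 < c < 5)%N ->
  eqmodX K (\prod_(i < K) ((1 - 'X^(5 * i + c)) * (1 - 'X^(5 * i + (5 - c))))
            * \prod_(i < K) (1 - 'X^(5 * i.+1))) (theta c K).
Proof.
move=> hc; rewrite finite_triple_product; last by lia.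
rewrite mulr_suml /theta /zbox big_map.
apply: (@eqmodX_trans _ (\sum_(j < (K + K).+1) zsign (j%:Z - K%:Z) *
   'X^(theta_exp c (j%:Z - K%:Z)))).
  apply: eqmodX_sum => j _ _; have hj := ltn_ord j.
  have -> : zsign (j%:Z - K%:Z) = (-1) ^+ (j + K).
    by rewrite /zsign -signr_odd -[in RHS]signr_odd; congr (_ ^+ nat_of_bool _); lia.
  rewrite -!mulrA; apply: eqmodXM; first exact: eqmodX_refl.
  rewrite mulrCA -[X in eqmodX _ _ X]mulr1.
  have := theta_exp_ge (j%:Z - K%:Z) hc.
  move: (theta_exp _ _) => e he.
  (* Here d = K - |j - K|: the Gaussian binomial is least accurate near the ends of the range, where
     the theta exponent, at least |j - K|, makes up for it. *)
  set d := minn j (K + K - j).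
  apply: (@eqmodX_leq (e + 5 * d.+1)); first by rewrite /d; lia.
  apply: eqmodX_mulXn.
  have -> : \prod_(i < K) (1 - 'X^(5 * i.+1)) = \prod_(i < K) (1 - 'X^5 ^+ i.+1) :> {poly int}.
    by under [in RHS]eq_bigr do rewrite -exprM.
  by apply: gbin_limit; rewrite /d; lia.
(* The finite identity runs over -K, ..., K, whereas [zbox K] stops at K-1; the extra term has order
   at least K. *)
rewrite big_ord_recr /= -[X in eqmodX _ _ X]addr0; apply: eqmodXD.
  rewrite -(big_mkord xpredT (fun j => zsign (j%:Z - K%:Z) * 'X^(theta_exp c (j%:Z - K%:Z)))).
  by rewrite /index_iota subn0 addnn -mul2n; apply: eqmodX_refl.
rewrite mulrC; apply: eqmodX_Xn; apply: leq_trans (theta_exp_ge _ hc); lia.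
Qed.

Lemma prod_residues (c L : nat) : (0 < c < 5)%N ->
  \prod_(1 <= k < (5 * L).+1 | (k %% 5)%N \in [:: 0; c; 5 - c]%N) (1 - 'X^k) =
  \prod_(i < L) ((1 - 'X^(5 * i + c)) * (1 - 'X^(5 * i + (5 - c))))
            * \prod_(i < L) (1 - 'X^(5 * i.+1)) :> {poly int}.
Proof.
move=> hc; elim: L => [|L IH]; first by rewrite big_geq // !big_ord0 mulr1.
rewrite !big_ord_recr /= mulrACA -IH big_mkcond mulnS.
rewrite -[((5 + 5 * L).+1)%N]/((5 * L).+2.+4)%N.
do 5 (rewrite big_nat_recr //=); rewrite -big_mkcond.
have -> : ((5 * L).+1 %% 5 = 1)%N by lia.
have -> : ((5 * L).+2 %% 5 = 2)%N by lia.
have -> : ((5 * L).+3 %% 5 = 3)%N by lia.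
have -> : ((5 * L).+4 %% 5 = 4)%N by lia.
have -> : ((5 * L).+1.+4 %% 5 = 0)%N by lia.
rewrite -!mulrA; congr (_ * _).
have -> : (5 + 5 * L = (5 * L).+1.+4)%N by [].
have [->|[->|[->|->]]] : (c = 1 \/ c = 2 \/ c = 3 \/ c = 4)%N by lia.
all: rewrite !inE /= ?mulr1 ?mul1r ?addn1 ?addn2 ?addn3 ?addn4 // mulrCA //.
Qed.

Lemma theta_prod (c n : nat) : (0 < c < 5)%N ->
  eqmodX n.+1 (\prod_(1 <= k < n.+1 | (k %% 5)%N \in [:: 0; c; 5 - c]%N) (1 - 'X^k)) (theta c n.+1).
Proof.
move=> hc; apply: eqmodX_trans (triple_product n.+1 hc); rewrite -prod_residues //.
rewrite [X in eqmodX _ _ X](@big_cat_nat _ _ _ n.+1) //=; last by lia.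
rewrite -[X in eqmodX _ X _]mulr1; apply: eqmodXM; first exact: eqmodX_refl.
apply/eqmodX_sym/eqmodX_prod1 => k; rewrite mem_index_iota => /andP[h _] _.
exact: eqmodX_sub_Xn.
Qed.

(** * The 5-dissection of [theta 4 * theta 3] *)

Lemma eq_zsignN (j k : int) : odd `|j|%N = ~~ odd `|k|%N -> zsign j = - zsign k.
Proof. by rewrite /zsign -signr_odd => ->; rewrite signrN signr_odd. Qed.

Definition theta2_term (p : int * int) : {poly int} :=
  zsign (p.1 + p.2) * 'X^(theta_exp 4 p.1 + theta_exp 3 p.2).

(* The cosets of the sublattice of index 5 spanned by (2, -1) and (1, 2). *)
Definition lattice_class (p : int * int) : 'I_5 := inord `|((p.1 + 2 * p.2) %% 5)%Z|.

Lemma lattice_classE (p : int * int) (t : 'I_5) :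
  (lattice_class p == t) = (((p.1 + 2 * p.2) %% 5)%Z == t%:Z).
Proof.
have h0 := modz_ge0 (p.1 + 2 * p.2) (isT : 5 != 0 :> int).
have h5 := ltz_mod (p.1 + 2 * p.2) (isT : 5 != 0 :> int).
rewrite -val_eqE /= inordK; lia.
Qed.

Definition zbox2 (L : nat) : seq (int * int) := [seq (m, n) | m <- zbox L, n <- zbox L].

Lemma mem_zbox2 L p : (p \in zbox2 L) = (p.1 \in zbox L) && (p.2 \in zbox L).
Proof.
apply/allpairsP/andP => [[[m n] [h1 h2 ->]] //|[h1 h2]].
by exists p; split=> //; case: p {h1 h2}.
Qed.

Lemma zbox2_uniq L : uniq (zbox2 L).
Proof. by apply: allpairs_uniq (zbox_uniq L) (zbox_uniq L) _ => -[? ?] [? ?]. Qed.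

Lemma theta_mul K :
  theta 4 K * theta 3 K = \sum_(p <- zbox2 K) theta2_term p.
Proof.
rewrite /theta big_distrlr /= big_allpairs; apply: eq_bigr => m _; apply: eq_bigr => n _.
by rewrite /theta2_term /= zsignD exprD; ring.
Qed.

(** [phi] parametrises the coset [t]. Since terms with |m| + |n| >= K vanish modulo X^K, the shape
    of the boxes is immaterial and [phi] need only reach the points near the origin. *)
Lemma lattice_class_sum K (t : 'I_5) (phi : int -> int -> int * int) :
    (forall u v u' v', phi u v = phi u' v' -> u = u' /\ v = v') ->
    (forall u v, lattice_class (phi u v) == t) ->
    (forall p, lattice_class p == t -> (`|p.1| + `|p.2| < K)%N ->
       exists u v, [/\ u \in zbox K, v \in zbox K & phi u v = p]) ->
  eqmodX K (\sum_(p <- zbox2 K | lattice_class p == t) theta2_term p)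
           (\sum_(u <- zbox K) \sum_(v <- zbox K) theta2_term (phi u v)).
Proof.
move=> inj cls surj.
have small p : (K <= `|p.1| + `|p.2|)%N -> eqmodX K (theta2_term p) 0.
  move=> h; rewrite /theta2_term mulrC; apply: eqmodX_Xn.
  apply: leq_trans h _; apply: leq_add; exact: theta_exp_ge.
have -> : \sum_(u <- zbox K) \sum_(v <- zbox K) theta2_term (phi u v) =
    \sum_(p <- [seq phi u v | u <- zbox K, v <- zbox K]) theta2_term p.
  by rewrite big_allpairs_dep.
rewrite -big_filter.
apply: eqmodX_big_seq.
- by rewrite filter_uniq // zbox2_uniq.
- apply: allpairs_uniq (zbox_uniq K) (zbox_uniq K) _ => -[u v] [u' v'] _ _ /= /inj.
  by case=> -> ->.
- move=> p; rewrite mem_filter => /andP[pt _] /negP h; apply: small.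
  rewrite leqNgt; apply/negP => /(surj _ pt)[u [v [hu hv e]]]; apply: h.
  by apply/allpairsP; exists (u, v).
- move=> p /allpairsP[[u v] [_ _ /= ->]]; rewrite mem_filter cls mem_zbox2 !mem_zbox /= => h.
  by apply: small; lia.
Qed.

Lemma zbox_reflect L (F : int -> {poly int}) :
  \sum_(u <- zbox L) F (- 1 - u) = \sum_(u <- zbox L) F u.
Proof.
rewrite -(big_map (fun u => - 1 - u) xpredT F); apply: perm_big; apply: uniq_perm.
- by rewrite map_inj_uniq ?zbox_uniq // => x y; lia.
- exact: zbox_uniq.
move=> x; rewrite mem_zbox; apply/mapP/andP => [[u]|h].
  by rewrite mem_zbox => h ->; lia.
by exists (- 1 - x); [rewrite mem_zbox|]; lia.
Qed.

(** The reflection shows that the sum equals its own opposite, and the integers have no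
    2-torsion. *)
Lemma zbox_antisym L (F : int -> {poly int}) :
  (forall u, F (- 1 - u) = - F u) -> \sum_(u <- zbox L) F u = 0.
Proof.
move=> h; have := zbox_reflect L F; under eq_bigr do rewrite h.
rewrite sumrN; move: (\sum_(u <- _) _) => S e; apply/polyP => i.
have := congr1 (fun p : {poly int} => p`_i) e; rewrite /= coefN coef0 => /eqP.
by rewrite eq_sym -addr_eq0 -mulr2n mulrn_eq0 /= => /eqP.
Qed.

Lemma theta_comp c L :
  theta c L \Po 'X^5 = \sum_(k <- zbox L) zsign k * 'X^(5 * theta_exp c k).
Proof.
rewrite /theta -[LHS]/(comp_poly _ _) raddf_sum /=; apply: eq_bigr => k _.
rewrite comp_polyM comp_Xn_poly -exprM; congr (_ * _).
by rewrite /zsign rmorphXn /= rmorphN1.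
Qed.

Lemma theta_dissection K :
  eqmodX K (theta 4 K * theta 3 K)
    ((theta 3 K \Po 'X^5) ^+ 2 - 'X * (theta 4 K \Po 'X^5) * (theta 3 K \Po 'X^5)
     - 'X^2 * (theta 4 K \Po 'X^5) ^+ 2).
Proof.
rewrite theta_mul (partition_big lattice_class xpredT) //= !big_ord_recl big_ord0.
have mulE c d : (theta c K \Po 'X^5) * (theta d K \Po 'X^5) =
    \sum_(u <- zbox K) \sum_(v <- zbox K)
       zsign u * zsign v * 'X^(5 * (theta_exp c u + theta_exp d v)).
  rewrite !theta_comp big_distrlr /=; apply: eq_bigr => u _; apply: eq_bigr => v _.
  by rewrite mulnDr exprD; ring.
(* The summands are put in the order of the classes 0 to 4; classes 1 and 2 are the two that
   vanish. *)
have -> : (theta 3 K \Po 'X^5) ^+ 2 - 'X * (theta 4 K \Po 'X^5) * (theta 3 K \Po 'X^5)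
     - 'X^2 * (theta 4 K \Po 'X^5) ^+ 2 =
   (theta 3 K \Po 'X^5) * (theta 3 K \Po 'X^5) + (0 + (0 +
     (- 'X^2 * ((theta 4 K \Po 'X^5) * (theta 4 K \Po 'X^5)) + (
     (- 'X * ((theta 4 K \Po 'X^5) * (theta 3 K \Po 'X^5))) + 0)))) by ring.
rewrite !mulE.
have exps u v m n a c d : (c <= 5)%N -> (d <= 5)%N ->
    5 * m * (m - 1) + 8 * m + (5 * n * (n - 1) + 6 * n) = 2 * a%:Z +
      5 * (5 * u * (u - 1) + 2 * c%:Z * u + (5 * v * (v - 1) + 2 * d%:Z * v)) ->
    (theta_exp 4 m + theta_exp 3 n = a + 5 * (theta_exp c u + theta_exp d v))%N.
  move=> hc hd.
  have := theta_expE u hc; have := theta_expE v hd.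
  have := @theta_expE 4 m isT; have := @theta_expE 3 n isT.
  by lia.
have reflexps m n m' n' :
    5 * m * (m - 1) + 8 * m + (5 * n * (n - 1) + 6 * n) =
      5 * m' * (m' - 1) + 8 * m' + (5 * n' * (n' - 1) + 6 * n') ->
    (theta_exp 4 m + theta_exp 3 n = theta_exp 4 m' + theta_exp 3 n')%N.
  have := @theta_expE 4 m isT; have := @theta_expE 3 n isT.
  have := @theta_expE 4 m' isT; have := @theta_expE 3 n' isT.
  by lia.
apply: eqmodXD; [|apply: eqmodXD; [|apply: eqmodXD; [|apply: eqmodXD; [|apply: eqmodXD]]]].
(* The basis vectors (2, -1) and (1, 2) are orthogonal of squared length 5, so the exponent has no
   term in uv and is 5 times a sum of two theta exponents. *)
- apply: eqmodX_trans (lattice_class_sum (phi := fun u v => (2 * u + v, 2 * v - u)) _ _ _) _.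
  + by move=> u v u' v' [] /=; lia.
  + by move=> u v; rewrite lattice_classE /= /bump /=; lia.
  + move=> [m n]; rewrite lattice_classE /= /bump /= => h hK.
    (* The inverse of [phi]; both divisions are exact on this class. The other classes are treated
       alike. *)
    exists ((2 * m - n) %/ 5)%Z, ((m + 2 * n) %/ 5)%Z; rewrite !mem_zbox.
    split; [lia|lia|congr (_, _); lia].
  suff -> : \sum_(u <- zbox K) \sum_(v <- zbox K) theta2_term (2 * u + v, 2 * v - u) =
    \sum_(u <- zbox K) \sum_(v <- zbox K)
       zsign u * zsign v * 'X^(5 * (theta_exp 3 u + theta_exp 3 v)) by apply: eqmodX_refl.
  apply: eq_bigr => u _; apply: eq_bigr => v _; rewrite /theta2_term /=.
  rewrite (exps u v _ _ 0%N 3%N 3%N) // ; last by ring.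
  by rewrite -zsignD; congr (_ * _); apply: eq_zsign; lia.
- apply: eqmodX_trans (lattice_class_sum (phi := fun u v => (2 * u + v + 1, 2 * v - u)) _ _ _) _.
  + by move=> u v u' v' [] /=; lia.
  + by move=> u v; rewrite lattice_classE /= /bump /=; lia.
  + move=> [m n]; rewrite lattice_classE /= /bump /= => h hK.
    exists ((2 * m - n - 2) %/ 5)%Z, ((m + 2 * n - 1) %/ 5)%Z; rewrite !mem_zbox.
    split; [lia|lia|congr (_, _); lia].
  rewrite zbox_antisym; first exact: eqmodX_refl.
  (* For fixed v, the reflection of u preserves the exponent and changes the parity of m + n. In
     class 2 the reflection of v does the same. *)
  move=> u; rewrite -sumrN; apply: eq_bigr => v _; rewrite -mulNr /theta2_term /=.
  congr (_ * 'X^_).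
    apply: eq_zsignN; lia.
  by apply: reflexps; ring.
- apply: eqmodX_trans (lattice_class_sum (phi := fun u v => (2 * u + v + 2, 2 * v - u)) _ _ _) _.
  + by move=> u v u' v' [] /=; lia.
  + by move=> u v; rewrite lattice_classE /= /bump /=; lia.
  + move=> [m n]; rewrite lattice_classE /= /bump /= => h hK.
    exists ((2 * m - n - 4) %/ 5)%Z, ((m + 2 * n - 2) %/ 5)%Z; rewrite !mem_zbox.
    split; [lia|lia|congr (_, _); lia].
  rewrite exchange_big zbox_antisym; first exact: eqmodX_refl.
  move=> v; rewrite -sumrN; apply: eq_bigr => u _; rewrite -mulNr /theta2_term /=.
  congr (_ * 'X^_).
    apply: eq_zsignN; lia.
  by apply: reflexps; ring.
(* The base point (0, -1) has exponent 2 and sign -1, whence the factor -X^2; in class 4 the base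
   point (-1, 0) gives -X. The orientation of the basis makes the linear terms match. *)
- apply: eqmodX_trans (lattice_class_sum (phi := fun u v => (2 * u - v, - 1 - u - 2 * v)) _ _ _) _.
  + by move=> u v u' v' [] /=; lia.
  + by move=> u v; rewrite lattice_classE /= /bump /=; lia.
  + move=> [m n]; rewrite lattice_classE /= /bump /= => h hK.
    exists ((2 * m - n - 1) %/ 5)%Z, ((- m - 2 * n - 2) %/ 5)%Z; rewrite !mem_zbox.
    split; [lia|lia|congr (_, _); lia].
  suff -> : \sum_(u <- zbox K) \sum_(v <- zbox K) theta2_term (2 * u - v, - 1 - u - 2 * v) =
    - 'X^2 * \sum_(u <- zbox K) \sum_(v <- zbox K)
       zsign u * zsign v * 'X^(5 * (theta_exp 4 u + theta_exp 4 v)) by apply: eqmodX_refl.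
  rewrite mulr_sumr; apply: eq_bigr => u _; rewrite mulr_sumr; apply: eq_bigr => v _.
  rewrite /theta2_term /= (exps u v _ _ 2%N 4%N 4%N) //; last by ring.
  rewrite exprD mulrA; have -> : zsign (2 * u - v + (- 1 - u - 2 * v)) = - (zsign u * zsign v).
    rewrite -zsignD; apply: eq_zsignN; lia.
  by rewrite ?expr1; ring.
- apply: eqmodX_trans (lattice_class_sum (phi := fun u v => (- 1 - 2 * u - v, u - 2 * v)) _ _ _) _.
  + by move=> u v u' v' [] /=; lia.
  + by move=> u v; rewrite lattice_classE /= /bump /=; lia.
  + move=> [m n]; rewrite lattice_classE /= /bump /= => h hK.
    exists ((- 2 * m + n - 2) %/ 5)%Z, ((- m - 2 * n - 1) %/ 5)%Z; rewrite !mem_zbox.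
    split; [lia|lia|congr (_, _); lia].
  suff -> : \sum_(u <- zbox K) \sum_(v <- zbox K) theta2_term (- 1 - 2 * u - v, u - 2 * v) =
    - 'X * \sum_(u <- zbox K) \sum_(v <- zbox K)
       zsign u * zsign v * 'X^(5 * (theta_exp 4 u + theta_exp 3 v)) by apply: eqmodX_refl.
  rewrite mulr_sumr; apply: eq_bigr => u _; rewrite mulr_sumr; apply: eq_bigr => v _.
  rewrite /theta2_term /= (exps u v _ _ 1%N 4%N 3%N) //; last by ring.
  rewrite exprD mulrA; have -> : zsign (- 1 - 2 * u - v + (u - 2 * v)) = - (zsign u * zsign v).
    rewrite -zsignD; apply: eq_zsignN; lia.
  by rewrite ?expr1; ring.
- exact: eqmodX_refl.
Qed.

(** * Positivity *)

Lemma qpoch_trunc_comp m N : qpoch_trunc m N = qpoch_trunc 1 N \Po 'X^m.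
Proof.
rewrite /qpoch_trunc rmorph_prod; apply: eq_bigr => k _.
by rewrite rmorphB rmorph1 /= comp_Xn_poly -exprM mul1n.
Qed.

Lemma inv_qpoch_trunc_comp m N : inv_qpoch_trunc m N = inv_qpoch_trunc 1 N \Po 'X^m.
Proof.
rewrite /inv_qpoch_trunc rmorph_prod; apply: eq_bigr => k _.
rewrite raddf_sum; apply: eq_bigr => j _.
by rewrite /= comp_Xn_poly -exprM mul1n mulnA.
Qed.

Lemma eqmodX_geom n k : (0 < k)%N ->
  eqmodX n.+1 ((\sum_(0 <= j < n.+1) 'X^(k * j)) * (1 - 'X^k)) 1.
Proof.
move=> k0.
have -> : (\sum_(0 <= j < n.+1) 'X^(k * j)) * (1 - 'X^k) = 1 - 'X^(k * n.+1) :> {poly int}.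
  rewrite big_mkord exprM -[RHS]opprB subrX1.
  by under eq_bigr do rewrite exprM; ring.
by apply: eqmodX_sub_Xn; rewrite leq_pmull.
Qed.

(** Each 1 - X^k with [P k] cancels the geometric series of the same k. All k give the inverse of
    E_1; residue classes give A/E_1 and B/E_1. *)
Lemma inv_qpoch_trunc_mul n (P : pred nat) :
  eqmodX n.+1 (inv_qpoch_trunc 1 n * \prod_(1 <= k < n.+1 | P k) (1 - 'X^k))
    (\prod_(1 <= k < n.+1 | ~~ P k) \sum_(0 <= j < n.+1) 'X^(k * j)).
Proof.
rewrite /inv_qpoch_trunc; under eq_bigr do under eq_bigr do rewrite mul1n.
rewrite (bigID P) /= mulrAC -big_split /= -[X in eqmodX _ _ X]mul1r.
apply: eqmodXM; last exact: eqmodX_refl.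
apply: eqmodX_prod1 => k; rewrite mem_index_iota => /andP[k0 _] _.
exact: eqmodX_geom.
Qed.

(** Stable under products, and multiplication by such a polynomial keeps positive coefficients of a
    nonnegative one positive ([coefM_gt0]). *)
Definition nonneg_unitary (p : {poly int}) := (forall i, 0 <= p`_i) /\ p`_0 = 1.

Lemma nonneg_unitary1 : nonneg_unitary 1.
Proof. by split=> [i|]; rewrite coef1 //; case: eqP. Qed.

Lemma nonneg_unitaryM p r : nonneg_unitary p -> nonneg_unitary r -> nonneg_unitary (p * r).
Proof.
move=> [p0 p1] [r0 r1]; split=> [i|]; last by rewrite coef0M p1 r1.
by rewrite coefM; apply: sumr_ge0 => j _; apply: mulr_ge0.
Qed.

Lemma nonneg_unitaryX p m : nonneg_unitary p -> nonneg_unitary (p ^+ m).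
Proof.
move=> h; elim: m => [|m IH]; first exact: nonneg_unitary1.
by rewrite exprS; apply: nonneg_unitaryM.
Qed.

Lemma nonneg_unitary_geom n k : (0 < k)%N ->
  nonneg_unitary (\sum_(0 <= j < n.+1) 'X^(k * j)).
Proof.
move=> k0; split=> [i|].
  by rewrite coef_sum; apply: sumr_ge0 => j _; rewrite coefXn; case: eqP.
rewrite coef_sum big_nat_recl //= coefXn muln0 /= big1 ?addr0 // => j _.
by rewrite coefXn ltn_eqF // muln_gt0 k0.
Qed.

Lemma nonneg_unitary_prod_geom n m (P : pred nat) :
  nonneg_unitary (\prod_(1 <= k < m | P k) \sum_(0 <= j < n.+1) 'X^(k * j)).
Proof.
rewrite big_nat_cond; apply: (big_ind nonneg_unitary); [exact: nonneg_unitary1|exact: nonneg_unitaryM|].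
by move=> k /andP[/andP[k0 _] _]; apply: nonneg_unitary_geom.
Qed.

Lemma coefM_gt0 (p r : {poly int}) i : (forall i, 0 <= p`_i) -> 0 < p`_i -> nonneg_unitary r -> 0 < (p * r)`_i.
Proof.
move=> p0 pi [r0 r1]; rewrite coefM big_ord_recr /= subnn r1 mulr1.
by apply: ltr_wpDl => //; apply: sumr_ge0 => j _; apply: mulr_ge0.
Qed.

(** The factor k = 1 is 1 + X + ... + X^n, positive in all degrees up to n; the other factors are
    [nonneg_unitary]. For n = 0 the product is empty. *)
Lemma inv_qpoch_trunc_gt0 n i : (i <= n)%N -> 0 < (inv_qpoch_trunc 1 n)`_i.
Proof.
rewrite /inv_qpoch_trunc; under eq_bigr do under eq_bigr do rewrite mul1n.
case: n => [|n] hi.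
  by move: hi; rewrite leqn0 => /eqP->; rewrite big_geq // coef1.
rewrite big_ltn //; under eq_bigr do rewrite mul1n.
have g1 j : (\sum_(0 <= j < n.+2) 'X^j : {poly int})`_j = (j < n.+2)%:R.
  rewrite big_mkord (_ : \sum_(i < _) _ = \poly_(i < n.+2) 1) ?coef_poly; first by case: ltnP.
  by rewrite poly_def; apply: eq_bigr => k _; rewrite scale1r.
apply: coefM_gt0 => [j||]; [by rewrite g1 ler0n|by rewrite g1 ltnS hi|].
rewrite big_nat_cond; apply: (big_ind nonneg_unitary); [exact: nonneg_unitary1|exact: nonneg_unitaryM|].
by move=> k /andP[/andP[k0 _] _]; apply: nonneg_unitary_geom; lia.
Qed.

Lemma theta_monomial_gt0 n t m : (t <= 4)%N -> (m <= n)%N ->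
  0 < (theta 4 n.+1 ^+ t * theta 3 n.+1 ^+ (4 - t) * inv_qpoch_trunc 1 n ^+ 5)`_m.
Proof.
move=> ht hm.
have h c : (0 < c < 5)%N -> exists2 p, nonneg_unitary p &
    eqmodX n.+1 (theta c n.+1 * inv_qpoch_trunc 1 n) p.
  move=> hc; eexists; last first.
    apply: eqmodX_trans (inv_qpoch_trunc_mul _ _); rewrite mulrC.
    by apply: eqmodXM (eqmodX_sym (theta_prod n hc)); apply: eqmodX_refl.
  exact: nonneg_unitary_prod_geom.
have [p hp ep] := h 4%N isT; have [r hr er] := h 3%N isT.
(* One of the five factors 1/E_1 is kept aside to supply strict positivity; the other four are
   shared among the theta factors. *)
rewrite (_ : _ * _ = inv_qpoch_trunc 1 n * ((theta 4 n.+1 * inv_qpoch_trunc 1 n) ^+ t *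
    (theta 3 n.+1 * inv_qpoch_trunc 1 n) ^+ (4 - t))); last first.
  have -> : 5%N = (t + (4 - t)).+1 by lia.
  by rewrite exprS exprD !exprMn; ring.
rewrite (@eqmodX_coef n.+1 _ (inv_qpoch_trunc 1 n * (p ^+ t * r ^+ (4 - t)))) //; last first.
  by apply: eqmodXM; [apply: eqmodX_refl|apply: eqmodXM; apply: eqmodXX].
apply: coefM_gt0; last by apply: nonneg_unitaryM; apply: nonneg_unitaryX.
  rewrite /inv_qpoch_trunc; under eq_bigr do under eq_bigr do rewrite mul1n.
  by case: (nonneg_unitary_prod_geom n n.+1 xpredT).
exact: inv_qpoch_trunc_gt0.
Qed.

(** * Assembly: E_1 E_5 = A B and the signs by residue class *)

Lemma prod_residues_all (L : nat) :
  \prod_(1 <= k < (5 * L).+1) (1 - 'X^k) =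
  \prod_(i < L) ((1 - 'X^(5 * i + 4)) * (1 - 'X^(5 * i + (5 - 4)))) *
  \prod_(i < L) ((1 - 'X^(5 * i + 3)) * (1 - 'X^(5 * i + (5 - 3)))) *
  \prod_(i < L) (1 - 'X^(5 * i.+1)) :> {poly int}.
Proof.
elim: L => [|L IH]; first by rewrite big_geq // !big_ord0 !mulr1.
rewrite !big_ord_recr /= mulnS -[((5 + 5 * L).+1)%N]/((5 * L).+2.+4)%N.
do 5 (rewrite big_nat_recr //=); rewrite IH.
have -> : (5 + 5 * L = (5 * L).+1.+4)%N by [].
by rewrite addn1 addn2 addn3 addn4; ring.
Qed.

(** The multiples of 5 occur in both A and B: one copy completes the other residues to E_1, the
    second copy is E_5. *)
Lemma qpoch_mul_theta n :
  eqmodX n.+1 (qpoch_trunc 1 n * qpoch_trunc 5 n) (theta 4 n.+1 * theta 3 n.+1).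
Proof.
apply: eqmodX_trans (eqmodXM (triple_product n.+1 _) (triple_product n.+1 _)) => //.
set E5 := \prod_(i < n.+1) (1 - 'X^(5 * i.+1)).
rewrite mulrACA mulrA -prod_residues_all; apply: eqmodXM.
  rewrite /qpoch_trunc [X in eqmodX _ _ X](@big_cat_nat _ _ _ n.+1) //=; last by lia.
  rewrite -[X in eqmodX _ X _]mulr1; apply: eqmodXM.
    by under eq_bigr do rewrite mul1n; exact: eqmodX_refl.
  apply/eqmodX_sym/eqmodX_prod1 => k; rewrite mem_index_iota => /andP[h _] _.
  exact: eqmodX_sub_Xn.
rewrite /qpoch_trunc /E5 big_add1 /= big_mkord big_ord_recr /=.
rewrite -[X in eqmodX _ X _]mulr1; apply: eqmodXM; first exact: eqmodX_refl.
by apply/eqmodX_sym/eqmodX_sub_Xn; lia.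
Qed.

Lemma coef_mulXn_comp (p : {poly int}) t d m r : (t < d)%N -> (r < d)%N ->
  ('X^t * (p \Po 'X^d))`_(d * m + r) = if r == t then p`_m else 0.
Proof.
move=> ht hr; rewrite coefXnM coef_comp_poly_Xn; last by lia.
case: (eqVneq r t) => [->|ne].
  by rewrite ltnNge leq_addl /= addnK dvdn_mulr // mulKn //; lia.
case: ltnP => // h; case: ifP => // /dvdnP[j ej].
have : (d * m + r = j * d + t)%N by lia.
move/(congr1 (fun x => x %% d)%N); rewrite mulnC !modnMDl !modn_small // => e.
by rewrite e eqxx in ne.
Qed.

Theorem theorem1p3 : forall n : nat,
  ((n %% 5 == 0)%N || (n %% 5 == 3)%N || (n %% 5 == 4)%N -> 0 < a n) /\
  ((n %% 5 == 1)%N || (n %% 5 == 2)%N -> a n < 0).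
Proof.
move=> n.
pose W t := theta 4 n.+1 ^+ t * theta 3 n.+1 ^+ (4 - t) * inv_qpoch_trunc 1 n ^+ 5.
have aE : a n = ('X^0 * (W 0%N \Po 'X^5) - 2%:R *: ('X^1 * (W 1%N \Po 'X^5)) - 'X^2 * (W 2%N \Po 'X^5)
    + 2%:R *: ('X^3 * (W 3%N \Po 'X^5)) + 'X^4 * (W 4%N \Po 'X^5))`_n.
  rewrite /a; apply: (@eqmodX_coef n.+1) => //.
  have inv5 : eqmodX n.+1 (qpoch_trunc 5 n * inv_qpoch_trunc 5 n) 1.
    have := @inv_qpoch_trunc_mul n xpredT.
    rewrite [X in eqmodX _ _ X]big_pred0 // => /(@eqmodX_comp _ 5 _ _ isT).
    rewrite (qpoch_trunc_comp 5) (inv_qpoch_trunc_comp 5) -comp_polyM mulrC comp_polyC.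
    by rewrite [qpoch_trunc 1 n]/qpoch_trunc; under [in X in _ -> X]eq_bigr do rewrite mul1n.
  (* E_1^2 / E_5^3 = (E_1 E_5)^2 / E_5^5, so that the dissection of E_1 E_5 applies. *)
  apply: (@eqmodX_trans _ ((qpoch_trunc 1 n * qpoch_trunc 5 n) ^+ 2 * inv_qpoch_trunc 5 n ^+ 5)).
    rewrite (_ : _ * inv_qpoch_trunc 5 n ^+ 5 = qpoch_trunc 1 n ^+ 2 * inv_qpoch_trunc 5 n ^+ 3 *
       (qpoch_trunc 5 n * inv_qpoch_trunc 5 n) ^+ 2); last by ring.
    rewrite -[X in eqmodX _ X _]mulr1; apply: eqmodXM; first exact: eqmodX_refl.
    by apply: eqmodX_sym; rewrite -(expr1n _ 2); apply: eqmodXX.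
  have e := eqmodX_trans (qpoch_mul_theta n) (theta_dissection n.+1).
  apply: eqmodX_trans (eqmodXM (eqmodXX 2 e) (eqmodX_refl _ _)) _.
  rewrite /W (inv_qpoch_trunc_comp 5) !comp_polyM !rmorphXn /=.
  rewrite -!mul_polyC polyCMn polyC1.
  (* The square of B^2 - XAB - X^2 A^2; the coefficient of X^2 A^2 B^2 is 1 - 2 = -1. *)
  match goal with |- eqmodX _ ?x ?y => have -> : x = y by ring end.
  exact: eqmodX_refl.
have Wgt0 t : (t <= 4)%N -> 0 < (W t)`_(n %/ 5) by move=> h; apply: theta_monomial_gt0; lia.
have dE : n = (5 * (n %/ 5) + n %% 5)%N by lia.
have r5 : (n %% 5 < 5)%N by rewrite ltn_mod.
(* Only the component with t = n mod 5 reaches degree n, so its coefficient 1, -2, -1, 2 or 1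
   decides the sign. *)
have cW t : (t < 5)%N -> ('X^t * (W t \Po 'X^5))`_n = if (n %% 5)%N == t then (W t)`_(n %/ 5) else 0.
  by move=> ht; have := coef_mulXn_comp (W t) (n %/ 5) ht r5; rewrite -dE.
rewrite aE !(coefD, coefN, coefZ) !cW //.
have := Wgt0 0%N isT; have := Wgt0 1%N isT; have := Wgt0 2%N isT; have := Wgt0 3%N isT.
have := Wgt0 4%N isT.
move: (W _)`_(n %/ 5) (W 3%N)`_(n %/ 5) (W 2%N)`_(n %/ 5) (W 1%N)`_(n %/ 5) (W 0%N)`_(n %/ 5).
move: (n %% 5)%N r5 => r r5 x4 x3 x2 x1 x0.
by case: r r5 => [|[|[|[|[|]]]]] //=; lia.
Qed.
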